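(* Let $X$ and $Y$ be real locally convex topological vector spaces and let $F\colon X\rightrightarrows Y$ be a set-valued mapping whose graph is convex. Then: (a) If $\operatorname{gph}(F)$ is quasi-regular, then $$\operatorname{qri}\big(\operatorname{gph}(F)\big)\subset\big\{(x,y)\in X\times Y\;\big|\;x\in\operatorname{qri}\big(\operatorname{dom}(F)\big),\;y\in\operatorname{qri}\big(F(x)\big)\big\}.$$ (b) If $\operatorname{dom}(F)$ is quasi-regular, then $$\operatorname{qri}\big(\operatorname{gph}(F)\big)\supset\big\{(x,y)\in X\times Y\;\big|\;x\in\operatorname{qri}\big(\operatorname{dom}(F)\big),\;y\in\operatorname{qri}\big(F(x)\big)\big\}.$$
   Context: For a nonempty subset $A$ of a real locally convex topological vector space $Z$, $\operatorname{cone}(A):=\{ta\mid t\ge 0,\ a\in A\}$ and $\overline{\operatorname{cone}}(A)$ is its closure. For a nonempty convex set $\Omega\subset Z$, the intrinsic relative interior is $\operatorname{iri}(\Omega):=\{x\in\Omega\mid \operatorname{cone}(\Omega-x)\text{ is a linear subspace of }Z\}$ and the quasi-relative interior is $\operatorname{qri}(\Omega):=\{x\in\Omega\mid \overline{\operatorname{cone}}(\Omega-x)\text{ is a linear subspace of }Z\}$; by convention $\operatorname{iri}(\emptyset)=\operatorname{qri}(\emptyset)=\emptyset$. A convex set $\Omega$ is called quasi-regular if $\operatorname{qri}(\Omega)=\operatorname{iri}(\Omega)$. For a set-valued mapping $F\colon X\rightrightarrows Y$ (assigning to each $x\in X$ a possibly empty subset $F(x)\subset Y$), $\operatorname{gph}(F):=\{(x,y)\in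 X\times Y\mid y\in F(x)\}$ and $\operatorname{dom}(F):=\{x\in X\mid F(x)\ne\emptyset\}$. *)

(* Defs.v *)
From HB Require Import structures.
From mathcomp Require Import all_boot all_order all_algebra.
From mathcomp Require Import boolp classical_sets functions reals topology.
From mathcomp Require Import convex tvs.

Set Implicit Arguments.
Unset Strict Implicit.
Unset Printing Implicit Defensive.

Import Order.TTheory GRing.Theory Num.Theory.

Local Open Scope classical_set_scope.
Local Open Scope ring_scope.

Definition cone (R : realType) (Z : lmodType R) (A : set Z) : set Z :=
  [set t *: a | t in [set t : R | 0 <= t] & a in A].

Definition translate (R : realType) (Z : lmodType R) (A : set Z) (x : Z) :
  set Z := [set a - x | a in A].

Definition linear_subspace (R : realType) (Z : lmodType R) (A : set Z) : Prop :=
  submod_closed [in A].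

(* [iri] and [qri] are intended for convex sets; on the empty set they are
   empty, since their elements are taken in [A]. *)
Definition iri (R : realType) (Z : lmodType R) (A : set Z) : set Z :=
  [set x | A x /\ linear_subspace (cone (translate A x))].

Definition qri (R : realType) (Z : tvsType R) (A : set Z) : set Z :=
  [set x | A x /\ linear_subspace (closure (cone (translate A x)))].

Definition quasi_regular (R : realType) (Z : tvsType R) (A : set Z) : Prop :=
  convex_set A /\ qri A = iri A.

(* A set-valued mapping from X to Y is a function [X -> set Y]. *)
Definition gph (X Y : Type) (F : X -> set Y) : set (X * Y) :=
  [set z | F z.1 z.2].

Definition dom (X Y : Type) (F : X -> set Y) : set X :=
  [set x | F x !=set0].

(* Main.v *)
Require Import Defs.
From HB Require Import structures.
From mathcomp Require Import all_boot all_order all_algebra.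
From mathcomp Require Import boolp classical_sets functions reals topology.
From mathcomp Require Import convex tvs.
From mathcomp Require Import interval_inference.

Set Implicit Arguments.
Unset Strict Implicit.
Unset Printing Implicit Defensive.

Import Order.TTheory GRing.Theory Num.Theory.

Local Open Scope classical_set_scope.
Local Open Scope ring_scope.

(** Part (a) is purely algebraic once qri = iri on the graph: [cone (dom F - x)]
    is the projection on X of the subspace [cone (gph F - (x, y))] and
    [cone (F x - y)] is its section above 0; closures of subspaces are subspaces.
    For (b), let (a, b) be in the graph.  Since x is in the iri of the domain,
    x - a = t (a' - x) for some t >= 0 and some (a', b') in the graph, so that
    (a - x, b - y) + t (a' - x, b' - y) = (0, w) with w in [cone (F x - y)] by
    convexity.  Then -w is in the closure of [cone (F x - y)], and
    -(a - x, b - y) = t (a' - x, b' - y) + (0, -w) is in the closure of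
    [cone (gph F - (x, y))]. *)

Section linear_subspace.
Context {R : realType} {Z : lmodType R}.
Implicit Types (A : set Z) (u v : Z).

(** Trades the boolean predicate [[in A]] for plain membership, the form used throughout. *)
Lemma linear_subspaceP A :
  linear_subspace A <-> A 0 /\ forall (a : R) u v, A u -> A v -> A (a *: u + v).
Proof.
split=> [[A0 Al]|[A0 Al]]; split.
- exact: set_mem A0.
- by move=> a u v /mem_set Au /mem_set Av; apply: set_mem (Al a u v Au Av).
- exact: mem_set A0.
- by move=> a u v /set_mem Au /set_mem Av; apply/mem_set/Al.
Qed.

Lemma linear_subspaceN A u : linear_subspace A -> A u -> A (- u).
Proof.
by move=> /linear_subspaceP[A0 Al] Au; rewrite -[- u]addr0 -scaleN1r; apply: Al.
Qed.

End linear_subspace.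

Section cone.
Context {R : realType} {Z : lmodType R}.
Implicit Types (A : set Z) (u v x : Z) (s t : R).

Lemma coneZ A t u : 0 <= t -> cone A u -> cone A (t *: u).
Proof.
move=> t0 [s s0 [a Aa <-]]; exists (t * s); first exact: mulr_ge0.
by exists a => //; rewrite scalerA.
Qed.

Lemma cone_translate A t a x : 0 <= t -> A a ->
  cone (translate A x) (t *: (a - x)).
Proof. by move=> t0 Aa; exists t => //; exists (a - x) => //; exists a. Qed.

Lemma cone_translateP A x u : cone (translate A x) u ->
  exists2 t, 0 <= t & exists2 a, A a & u = t *: (a - x).
Proof. by move=> [t t0 [_ [a Aa <-] <-]]; exists t => //; exists a. Qed.

Lemma cone_translate0 A x : A x -> cone (translate A x) 0.
Proof. by move=> Ax; rewrite -(scale0r (x - x)); apply: cone_translate. Qed.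

Lemma convex_setP A a b t : convex_set A -> A a -> A b -> 0 <= t -> t <= 1 ->
  A (t *: a + (1 - t) *: b).
Proof.
move=> cA /mem_set Aa /mem_set Ab t0 t1.
exact: set_mem (cA a b (Itv01 t0 t1) Aa Ab).
Qed.

(** [s (a - x) + t (b - x)] equals [(s + t) (c - x)], where [c] is the convex combination of [a] and
    [b] with weights [s / (s + t)] and [t / (s + t)]. *)
Lemma cone_translateD A x u v : convex_set A ->
  cone (translate A x) u -> cone (translate A x) v ->
  cone (translate A x) (u + v).
Proof.
move=> cA /cone_translateP[s s0 [a Aa ->]] /cone_translateP[t t0 [b Ab ->]].
(* A zero total forces [s = t = 0], so the sum is [0]; otherwise the weight [s / (s + t)] is a
   genuine quotient. *)
have [st0|st0] := eqVneq (s + t) 0.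
  have /andP[/eqP -> /eqP ->] : (s == 0) && (t == 0) by rewrite -paddr_eq0// st0.
  by rewrite !scale0r addr0 -(scale0r (a - x)); apply: cone_translate.
have st_gt0 : 0 < s + t by rewrite lt_neqAle eq_sym st0 addr_ge0.
set r := s / (s + t).
have rs : (s + t) * r = s by rewrite mulrC divfK.
have rt : (s + t) * (1 - r) = t by rewrite mulrBr rs mulr1 addrAC subrr add0r.
have -> : s *: (a - x) + t *: (b - x) =
    (s + t) *: (r *: a + (1 - r) *: b - x).
  rewrite [RHS]scalerBr [in RHS]scalerDr !scalerA rs rt scalerDl opprD addrACA.
  by rewrite -!scalerBr.
apply: cone_translate; first exact: ltW.
apply: convex_setP => //; first exact: divr_ge0 (ltW _).
by rewrite ler_pdivrMr// mul1r lerDl.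
Qed.

End cone.

(** The preimage of the closed set [closure B] under [f] is closed and contains [A]. *)
Lemma closure_continuous (T U : topologicalType) (f : T -> U) (A : set T)
    (B : set U) : continuous f -> (forall x, A x -> closure B (f x)) ->
  forall x, closure A x -> closure B (f x).
Proof.
move=> cf fAB x clAx; apply: closed_closure => V /cf/clAx[a [Aa Va]].
by exists (f a); split => //; apply: fAB.
Qed.

Section closure_tvs.
Context {R : realType} {Z : tvsType R}.
Implicit Types (A : set Z) (u v x : Z).

Lemma addl_continuous u : continuous (fun v : Z => u + v).
Proof.
move=> v; apply: (@continuous2_cvg _ _ _ _ _ _ (cst u) id (fun a b => a + b)).
- exact: (@add_continuous Z (u, v)).
- exact: cvg_cst.
- exact: cvg_id.
Qed.

Lemma scaler_continuous (a : R) : continuous (fun v : Z => a *: v).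
Proof.
move=> v.
apply: (@continuous2_cvg _ R^o Z _ _ _ (cst (a : R^o)) id (fun b w => b *: w)).
- exact: (@scale_continuous R Z (a, v)).
- exact: cvg_cst.
- exact: cvg_id.
Qed.

(** The two arguments pass to the limit one at a time, so continuity of translations suffices. *)
Lemma closureD A u v : (forall u v, A u -> A v -> A (u + v)) ->
  closure A u -> closure A v -> closure A (u + v).
Proof.
move=> AD clu clv; rewrite addrC.
apply: closure_continuous clu; first exact: addl_continuous.
move=> {}u Au; rewrite addrC.
apply: closure_continuous clv; first exact: addl_continuous.
by move=> {}v Av; apply/subset_closure/AD.
Qed.

(** Multiples are only asked to lie in the closure, so that the lemma also covers a convex cone
    whose negatives are mere limits. *)
Lemma linear_subspace_closure A : A 0 -> (forall u v, A u -> A v -> A (u + v)) ->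
  (forall (a : R) u, A u -> closure A (a *: u)) -> linear_subspace (closure A).
Proof.
move=> A0 AD AZ; apply/linear_subspaceP; split; first exact: subset_closure.
move=> a u v clu clv; apply: closureD => //.
by apply: closure_continuous clu; [exact: scaler_continuous|exact: AZ].
Qed.

Lemma iri_sub_qri A : iri A `<=` qri A.
Proof.
move=> x [Ax /linear_subspaceP[A0 Al]]; split => //.
apply: linear_subspace_closure => //.
- by move=> u v Au Av; rewrite -[u]scale1r; apply: Al.
- by move=> a u Au; apply: subset_closure; rewrite -[_ *: _]addr0; apply: Al.
Qed.

(** The cone of a convex set already admits sums and nonnegative multiples; only the negatives of
    its generators remain to be checked. *)
Lemma convex_qriP A x : convex_set A -> A x ->
  (forall a, A a -> closure (cone (translate A x)) (- (a - x))) -> qri A x.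
Proof.
move=> cA Ax AN; split => //; apply: linear_subspace_closure.
- exact: cone_translate0.
- by move=> u v; apply: cone_translateD.
- have clZ (t : R) u : 0 <= t -> closure (cone (translate A x)) u ->
      closure (cone (translate A x)) (t *: u).
    move=> t0; apply: closure_continuous; first exact: scaler_continuous.
    by move=> v Cv; apply/subset_closure/coneZ.
  move=> a _ /cone_translateP[t t0 [b Ab ->]].
  have [a0|/ltW a0] := leP 0 a.
    by apply/subset_closure/coneZ/cone_translate.
  (* For [a <= 0], the vector is the nonnegative multiple [- a * t] of [- (b - x)]. *)
  rewrite scalerA -[_ *: _]opprK -scalerN -scaleNr -mulNr.
  by apply: clZ (AN _ Ab); rewrite mulr_ge0// oppr_ge0.
Qed.

End closure_tvs.

Section graph.
Context {R : realType} {X Y : lmodType R} (F : X -> set Y).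
Implicit Types (x u : X) (y v : Y).

Lemma cone_gph_fst x y (z : X * Y) :
  cone (translate (gph F) (x, y)) z -> cone (translate (dom F) x) z.1.
Proof.
move=> /cone_translateP[t t0 [[a b] Fab ->]].
by apply: cone_translate => //; exists b.
Qed.

Lemma cone_dom_lift x y u : cone (translate (dom F) x) u ->
  exists v, cone (translate (gph F) (x, y)) (u, v).
Proof.
move=> /cone_translateP[t t0 [a [b Fab] ->]]; exists (t *: (b - y)).
exact: (@cone_translate _ (X * Y)%type _ _ (a, b)).
Qed.

Lemma cone_gph_section x y v : F x y ->
  cone (translate (gph F) (x, y)) (0, v) <-> cone (translate (F x) y) v.
Proof.
move=> Fxy; split=> /cone_translateP[t t0].
  move=> [[a b] Fab [/esym/eqP]]; rewrite scaler_eq0 subr_eq0.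
  (* From [t (a - x) = 0]: either [t = 0] and the vector is [0], or [a = x] and [b] lies in
     [F x]. *)
  move=> /orP[/eqP-> -> | /eqP ax ->].
    by rewrite scale0r; apply: cone_translate0.
  by apply: cone_translate => //; rewrite -ax.
move=> [b Fxb ->].
have -> : (0 : X, t *: (b - y)) = t *: ((x, b) - (x, y)) :> X * Y.
  by congr pair; rewrite /= subrr scaler0.
exact: cone_translate.
Qed.

Lemma iri_gph x y : iri (gph F) (x, y) -> iri (dom F) x /\ iri (F x) y.
Proof.
move=> [Fxy /linear_subspaceP[L0 Ll]]; rewrite /gph /= in Fxy; split; split.
- by exists y.
- apply/linear_subspaceP; split; first by apply: cone_translate0; exists y.
  move=> a u u' /cone_dom_lift-/(_ y)[v Luv] /cone_dom_lift-/(_ y)[v' Luv'].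
  exact: cone_gph_fst (Ll a _ _ Luv Luv').
- exact: Fxy.
- apply/linear_subspaceP; split; first exact: cone_translate0.
  move=> a v v' /(cone_gph_section _ Fxy) Lv /(cone_gph_section _ Fxy) Lv'.
  apply/(cone_gph_section _ Fxy).
  by have := Ll a _ _ Lv Lv'; congr (cone _ _); congr pair; rewrite /= scaler0 addr0.
Qed.

End graph.

(** The embedding of [Y] as [0 * Y] is continuous and sends the cone of the section into that of the
    graph. *)
Lemma closure_cone_gph_section (R : realType) (X Y : tvsType R)
    (F : X -> set Y) x y v : F x y ->
  closure (cone (translate (F x) y)) v ->
  closure (cone (translate (gph F) (x, y))) (0, v).
Proof.
move=> Fxy; apply: (@closure_continuous Y (X * Y)%type (fun w => (0, w))).
  by move=> w; apply: cvg_pair; [exact: cvg_cst|exact: cvg_id].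
by move=> w Cw; apply/subset_closure/cone_gph_section.
Qed.

(** [iri] on the domain gives an exact cancellation of the first coordinate, which lands in the
    section; there a negative obtained as a limit is enough, hence [qri] on [F x]. *)
Lemma qri_gph (R : realType) (X Y : tvsType R) (F : X -> set Y) x y :
  convex_set (gph F) -> iri (dom F) x -> qri (F x) y -> qri (gph F) (x, y).
Proof.
move=> cF [_ Lx] [Fxy Ly]; apply: convex_qriP => // -[a b] Fab.
have Cab : cone (translate (gph F) (x, y)) ((a, b) - (x, y)).
  by rewrite -[_ - _]scale1r; apply: cone_translate.
(* Here [v'] is the [t (b' - y)] of the sketch, so that [w = b - y + v']. *)
have [v' Cv'] := cone_dom_lift y (linear_subspaceN Lx (cone_gph_fst Cab)).
have := cone_translateD cF Cab Cv'.
have -> : ((a, b) - (x, y)) + (- ((a, b) - (x, y)).1, v') =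
    (0, b - y + v') :> X * Y by congr pair; rewrite /= subrr.
move=> /(cone_gph_section _ Fxy)/subset_closure/(linear_subspaceN Ly).
move=> /(closure_cone_gph_section Fxy) Cw.
have -> : - ((a, b) - (x, y)) =
    (- ((a, b) - (x, y)).1, v') + (0, - (b - y + v')) :> X * Y.
  by congr pair; rewrite /= ?addr0// [b - y + v']addrC [in RHS]opprD addNKr.
apply: closureD Cw; last exact: subset_closure.
by move=> u w; apply: cone_translateD.
Qed.

Theorem theorem4p3 (R : realType) (X Y : tvsType R) (F : X -> set Y)
    (gphF_convex : convex_set (gph F)) :
  (quasi_regular (gph F) ->
     qri (gph F) `<=`
       [set z : X * Y | qri (dom F) z.1 /\ qri (F z.1) z.2]) /\
  (quasi_regular (dom F) ->
     [set z : X * Y | qri (dom F) z.1 /\ qri (F z.1) z.2] `<=`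
       qri (gph F)).
Proof.
(* Quasi-regularity turns [qri] into [iri] on the graph in (a) and on the domain in (b). *)
split=> [[_ ->] [x y] /iri_gph[dx Fy]|[_ ->] [x y] [/= dx Fy]].
  by split; apply: iri_sub_qri.
exact: qri_gph.
Qed.
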